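(* Let $n\ge2$, let $\overrightarrow{C_n}$ be the cycle on $n$ vertices oriented cyclically with underlying undirected graph $C_n$, and let $X_{\overrightarrow{C_n}}(\mathbf{x},t)=\sum_{\lambda\vdash n}c_\lambda(t)e_\lambda$. Then for every partition $\lambda=(\lambda_1,\dots,\lambda_k)$ of $n$, $$c_\lambda(t)=\sum_{\bar a\in AO_\lambda(C_n)}t^{\mathrm{asc}_{\overrightarrow{C_n}}(\bar a)},$$ where $AO_\lambda(C_n)$ is the set of all acyclic orientations $\bar a$ of $C_n$ such that the numbers of vertices between consecutive sinks of $\bar a$ are $\lambda_1-1,\lambda_2-1,\dots,\lambda_k-1$ in any order, and $\mathrm{asc}_{\overrightarrow{C_n}}(\bar a)$ is the number of edges of $\overrightarrow{C_n}$ for which the orientations of $\overrightarrow{C_n}$ and $\bar a$ agree.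
   Context: $\overrightarrow{C_n}$ is the digraph on $[n]$ with directed edges $1\to2\to\cdots\to n\to1$ (for $n=2$: the two directed edges $1\to2$, $2\to1$, with underlying graph a single edge). For a digraph $\overrightarrow{G}=(V,E)$, a proper coloring is a map $\kappa:V\to\mathbb{P}=\{1,2,3,\dots\}$ with $\kappa(u)\ne\kappa(v)$ whenever $u,v$ are adjacent, $\mathrm{asc}(\kappa)=|\{(u,v)\in E:\kappa(u)<\kappa(v)\}|$ (where $(u,v)$ is directed from $u$ to $v$), and $$X_{\overrightarrow{G}}(\mathbf{x},t)=\sum_{\kappa}t^{\mathrm{asc}(\kappa)}\prod_{v\in V}x_{\kappa(v)},$$ summed over all proper colorings. For $\overrightarrow{C_n}$ this is a polynomial in $t$ with symmetric function coefficients; $e_\lambda=e_{\lambda_1}e_{\lambda_2}\cdots$ are the elementary symmetric functions and $c_\lambda(t)\in\mathbb{Q}[t]$. A sink of an orientation is a vertex with no outgoing edges. Consecutive sinks are taken going cyclically around the cycle: if the sinks in cyclic order are $s_1,\dots,s_k$, one counts the vertices strictly between $s_i$ and $s_{i+1}$ (with $s_{k+1}=s_1$) along the cyclic direction, giving $k$ numbers, required to equal $\lambda_1-1,\dots,\lambda_k-1$ as a multiset. If there is a single sink, the only such number is $n-1$. Example for $n=9$: sinks $2,6,8$ give the numbers $3,1,2$, corresponding to $\lambda=(4,3,2)$. *)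

(* Defs.v *)
From HB Require Import structures.
From mathcomp Require Import all_boot all_order all_algebra.
From mathcomp Require Import finmap multiset.

Set Implicit Arguments.
Unset Strict Implicit.
Unset Printing Implicit Defensive.

Import GRing.Theory.
Local Open Scope ring_scope.

(** * Formal power series over Q[t] in countably many variables *)

(* The colour set {1, 2, 3, ...} is represented by nat, the number i standing
   for the colour i+1; only the order of the colours matters.  A monomial in
   the variables x_1, x_2, ... is the multiset of its (indices of) variables,
   so that [msetD] is the product of monomials and [mset0] the monomial 1.
   The variable t of Q[t] = {poly rat} is 'X. *)
Notation monomial := {mset nat}%mset.

Definition series := monomial -> {poly rat}.

(* Divisors of the monomial m, without repetition. *)
Definition mdivisors (m : monomial) : seq monomial :=
  undup [seq seq_mset (mask b (m : seq nat)) | b : (size m).-tuple bool].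

Lemma mem_mdivisors (d m : monomial) : (d \in mdivisors m) = (d `<=` m)%mset.
Proof.
rewrite mem_undup; apply/imageP/msubsetP => [[b _ ->] i|led].
  by rewrite mset_seqE -[m i]count_mem_mset leq_count_subseq ?mask_subseq.
have /count_subseqP [s /subseqP [b sz_b ->] d_eq] :
    forall x, (count_mem x d <= count_mem x m)%N.
  by move=> x; rewrite !count_mem_mset.
have sb : size b == size m by rewrite sz_b.
exists (Tuple sb) => //=; rewrite -[LHS]seq_mset_id.
exact/eq_seq_msetP.
Qed.

Definition series_one : series := fun m => (m == mset0)%:R.

Definition series_mul (f g : series) : series :=
  fun m => \sum_(d <- mdivisors m) f d * g (m `\` d)%mset.

(* e_k is the sum of all squarefree monomials of degree k. *)
Definition elem_sym (k : nat) : series :=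
  fun m => ((size m == k) && uniq m)%:R.

Definition elem_sym_part (la : seq nat) : series :=
  \big[series_mul/series_one]_(k <- la) elem_sym k.

(** * Integer partitions *)

Definition is_intpart (n : nat) (la : seq nat) : bool :=
  [&& sorted geq la, 0%N \notin la & sumn la == n].

Record intpart (n : nat) :=
  IntPart { parts :> seq nat; partsP : is_intpart n parts }.

HB.instance Definition _ n := [isSub for @parts n].
HB.instance Definition _ n := [Countable of intpart n by <:].

Lemma intpart_bounds n (la : intpart n) :
  (size la <= n)%N && all (fun k => (k <= n)%N) la.
Proof.
case: la => la /= /and3P [_ + /eqP <-].
elim: la => //= k la IH; rewrite inE negb_or eq_sym -lt0n => /andP [k0 /IH].
case/andP=> sz le_la; rewrite leq_addr /= -add1n leq_add //=.
by apply/allP => x /(allP le_la) h; apply: leq_trans h (leq_addl _ _).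
Qed.

(* Finiteness: a partition of n is a list of at most n integers at most n. *)
Definition intpart_code n (la : intpart n) : n.-bseq 'I_n.+1 :=
  insub_bseq n [seq inord k | k <- la].

Definition intpart_decode n (s : n.-bseq 'I_n.+1) : option (intpart n) :=
  insub [seq val k | k <- s].

Lemma intpart_codeK n : pcancel (@intpart_code n) (@intpart_decode n).
Proof.
move=> la; have /andP [sz le_la] := intpart_bounds la.
rewrite /intpart_decode /intpart_code /insub_bseq insubdK ?unfold_in ?size_map //.
rewrite -map_comp (_ : map _ _ = la) ?valK // -[RHS]map_id.
by apply/eq_in_map => k /(allP le_la) h /=; rewrite inordK.
Qed.

HB.instance Definition _ n := isFinite.Build (intpart n)
  (pcan_enumP (@intpart_codeK n)).

(** * Chromatic quasisymmetric functions of digraphs *)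

Section Digraph.

Variables (V : finType) (E : rel V).

Definition adjacent : rel V := [rel u v | E u v || E v u].

Definition proper_coloring (k : V -> nat) : bool :=
  [forall u, forall v, adjacent u v ==> (k u != k v)].

Definition asc_coloring (k : V -> nat) : nat :=
  #|[set p : V * V | E p.1 p.2 && (k p.1 < k p.2)%N]|.

(* The coefficient of the monomial m collects the proper colourings k with
   \prod_v x_(k v) = m; all their colours lie in the finite support of m. *)
Definition chromatic_qsym : series := fun m =>
  \sum_(k : {ffun V -> finsupp m} |
          proper_coloring (fun v => val (k v))
          && (seq_mset [seq val (k v) | v : V] == m))
     'X^(asc_coloring (fun v => val (k v))).

(* An orientation of the underlying undirected graph is given by its set of
   arcs: exactly one of (u, v), (v, u) for every edge {u, v}. *)
Definition orientation (a : {set V * V}) : bool :=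
  [forall u, forall v,
     if adjacent u v then ((u, v) \in a) (+) ((v, u) \in a)
     else (u, v) \notin a].

(* No directed cycle; a directed cycle is a nonempty list of distinct vertices,
   hence has at most #|V| of them. *)
Definition acyclic (a : {set V * V}) : bool :=
  ~~ [exists c : #|V|.-bseq V,
        (0 < size c)%N && ucycleb [rel u v | (u, v) \in a] c].

Definition asc_orientation (a : {set V * V}) : nat :=
  #|[set p in a | E p.1 p.2]|.

Definition sink (a : {set V * V}) (v : V) : bool :=
  [forall w, (v, w) \notin a].

End Digraph.

(** * The oriented cycle *)

(* Vertices are numbered from 0; [ordS] is the successor modulo n. *)
Definition dcycle (n : nat) : rel 'I_n := [rel i j | j == ordS i].

(* Number of vertices strictly between i and j when walking from i to j along
   the oriented cycle; it is n-1 when i = j. *)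
Definition between (n : nat) (i j : 'I_n) : nat := ((j + n - i).-1 %% n)%N.

(* [enum] lists the sinks in increasing order, and [next] is the cyclic
   successor in that list. *)
Definition sink_gaps (n : nat) (a : {set 'I_n * 'I_n}) : seq nat :=
  let s := enum (sink a) in [seq between i (next s i) | i <- s].

Definition AO (n : nat) (la : intpart n) : {set {set 'I_n * 'I_n}} :=
  [set a | [&& orientation (@dcycle n) a, acyclic a
             & perm_eq (sink_gaps a) [seq k.-1 | k <- la]]].

Definition e_expansion (n : nat) (f : series) (c : intpart n -> {poly rat}) :=
  forall m : monomial, f m = \sum_(la : intpart n) c la * elem_sym_part la m.

(* Main.v *)
Require Import Defs.
From mathcomp Require Import all_boot all_order all_algebra.
From mathcomp Require Import finmap multiset mpoly ring zify.

(* Let M be the matrix with entries M_ij = x_j t for i < j, x_j for i > j and 0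
   for i = j, so that the coefficients of tr M^n are those of the chromatic
   quasisymmetric function of the n-cycle.  Splitting M into an upper triangular
   matrix and a matrix of rank one yields
     \sum_(n > 0) tr M^n z^n = - z P'(z) / P(z),
     P(z) = 1 - \sum_k (t + ... + t^(k-1)) e_k z^k.
   An orientation of the cycle is a cyclic word whose letters say which edges
   agree with the cyclic orientation; cutting it at its sinks gives blocks 0^p 1^q
   with p, q > 0, and the blocks of length k contribute (t + ... + t^(k-1)) e_k.
   Hence the sum over words satisfies the same linear recursion in n as tr M^n.
   Uniqueness of the coefficients is the linear independence of the e_la, seen on
   the monomial with la_j distinct factors x_0 ... x_(la_j - 1) for each j. *)

Set Implicit Arguments.
Unset Strict Implicit.
Unset Printing Implicit Defensive.

Import GRing.Theory.
Local Open Scope ring_scope.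

(** * Logarithmic derivatives of power series *)

Lemma big_triangle (V : nmodType) (n : nat) (f : nat -> nat -> V) :
  \sum_(k < n) \sum_(j < n - k) f k j = \sum_(j < n) \sum_(k < n - j) f k j.
Proof.
have widen (g : nat -> V) k : (\sum_(j < n - k) g j = \sum_(j < n | (j < n - k)%N) g j).
  by rewrite (big_ord_widen _ _ (leq_subr k n)).
under eq_bigr => k _ do rewrite (widen (f k)).
under [RHS]eq_bigr => j _ do rewrite (widen (f^~ j)).
rewrite (exchange_big_dep predT) //=; apply: eq_bigr => j _.
by apply: eq_bigl => k; lia.
Qed.

Section LogDerivative.

Variable R : comNzRingType.

(* [newton c y] says that y_m is the coefficient of z^(m+1) in the power series
   z C'(z) / (1 - C(z)), where C(z) = \sum_k c_k z^(k+1). *)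
Definition newton (c y : nat -> R) :=
  forall m, y m = c m *+ m.+1 + \sum_(j < m) c j * y (m.-1 - j)%N.

Lemma newton_unique c y y' : newton c y -> newton c y' -> y =1 y'.
Proof.
move=> Hy Hy'; elim/ltn_ind => m IH; rewrite Hy Hy'; congr (_ + _).
by apply: eq_bigr => j _; rewrite IH //; have := ltn_ord j; lia.
Qed.

(** Congruence modulo z^(n+1): power series are handled as polynomials compared up to degree n. *)
Definition eqm n (p q : {poly R}) := forall k, (k <= n)%N -> p`_k = q`_k.

Lemma eqm_trans n p q r : eqm n p q -> eqm n q r -> eqm n p r.
Proof. by move=> pq qr k kn; rewrite pq ?qr. Qed.

Lemma eqm_sym n p q : eqm n p q -> eqm n q p.
Proof. by move=> pq k kn; rewrite pq. Qed.

Lemma eqmD n p q p' q' : eqm n p q -> eqm n p' q' -> eqm n (p + p') (q + q').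
Proof. by move=> pq pq' k kn; rewrite !coefD pq ?pq'. Qed.

Lemma eqmN n p q : eqm n p q -> eqm n (- p) (- q).
Proof. by move=> pq k kn; rewrite !coefN pq. Qed.

Lemma eqmM n p q p' q' : eqm n p q -> eqm n p' q' -> eqm n (p * p') (q * q').
Proof.
move=> pq pq' k kn; rewrite !coefM; apply: eq_bigr => i _.
by rewrite pq ?pq' //; have := ltn_ord i; lia.
Qed.

Lemma eqmMr n p q r : eqm n p q -> eqm n (p * r) (q * r).
Proof. by move=> pq; apply: eqmM. Qed.

Lemma eqm_deriv n p q : eqm n p q -> eqm n ('X * p^`()) ('X * q^`()).
Proof.
by move=> pq [|k] kn; rewrite !coefXM //= !coef_deriv pq.
Qed.

(** As in [newton], the coefficient [c k] sits in degree k + 1. *)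
Definition trunc n (c : nat -> R) : {poly R} :=
  \poly_(k < n.+1) (if k is k'.+1 then c k' else 0).

Lemma coef_trunc n c k :
  (trunc n c)`_k = if (k < n.+1)%N then if k is k'.+1 then c k' else 0 else 0.
Proof. by rewrite coef_poly. Qed.

Lemma coef_truncM n c y m : (m < n)%N ->
  (trunc n y * (1 - trunc n c))`_m.+1 = y m - \sum_(j < m) c j * y (m.-1 - j)%N.
Proof.
move=> mn; rewrite mulrBr mulr1 coefB coef_trunc ltnS mn; congr (_ - _).
rewrite mulrC coefM big_ord_recl coef_trunc /= mul0r add0r.
rewrite big_ord_recr /= subSS subnn [X in _ * X]coef_trunc mulr0 addr0.
apply: eq_bigr => j _; have jm := ltn_ord j; rewrite !coef_trunc /bump /= add1n.
rewrite subSS ltnS (ltn_trans jm mn) ltnS (leq_trans (leq_subr _ _) (ltnW mn)).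
case E : (m - j)%N => [|r]; first by lia.
by congr (_ * y _); lia.
Qed.

(** The recursion is Y (1 - C) = z C' read off degree by degree; degree m + 1 is already exact at
    truncation order m + 1. *)
Lemma newton_trunc c y :
  newton c y <->
  (forall n, eqm n (trunc n y * (1 - trunc n c)) ('X * (trunc n c)^`())).
Proof.
split=> [H n [|m] mn | H m].
- by rewrite coefXM mulrBr mulr1 coefB coefM big_ord1 !coef_trunc mul0r subr0.
- by rewrite coef_truncM // coefXM coef_deriv coef_trunc ltnS mn {1}(H m) addrK.
have := H m.+1 m.+1 (leqnn _); rewrite coef_truncM // coefXM coef_deriv coef_trunc.
by rewrite ltnS leqnn /= => <-; rewrite subrK.
Qed.

End LogDerivative.

(** * Traces of powers under a perturbation of rank one *)

Section RankOne.

Variables (R : comNzRingType) (N : nat) (Phi : 'M[R]_N.+1).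
Variables (u : 'cV[R]_N.+1) (v : 'rV[R]_N.+1).

Let M := Phi + u *m v.
Let F k : R := (v *m Phi ^+ k *m u) 0 0.
Let G k m : R := (v *m Phi ^+ k *m M ^+ m *m u) 0 0.

(** Telescoping: the factors [M] are replaced by [Phi] one at a time from the right, each
    replacement leaving a factor M - Phi = u v. *)
Lemma rank_one_expansion m :
  M ^+ m = Phi ^+ m + \sum_(j < m) M ^+ (m.-1 - j) *m (u *m v) *m Phi ^+ j.
Proof.
elim: m => [|m IH]; first by rewrite big_ord0 addr0.
rewrite exprSr {2}/M mulrDr {1}IH mulrDl -exprSr -addrA; congr (_ + _).
rewrite big_ord_recl /= subn0 expr0 mulmx1 addrC; congr (_ + _).
rewrite mulr_suml; apply: eq_bigr => j _ /=; rewrite /bump /= add1n.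
have -> : (m - j.+1 = m.-1 - j)%N by lia.
by rewrite -[LHS]/(_ *m _) -mulmxA exprSr.
Qed.

Let GE k m : G k m = F (k + m) + \sum_(j < m) F j * G k (m.-1 - j).
Proof.
rewrite /G {1}rank_one_expansion mulmxDr mulmxDl mxE -[_ *m Phi ^+ m]mulmxA.
rewrite [Phi ^+ k *m _](_ : _ = Phi ^+ (k + m)); last by rewrite exprD.
congr (_ + _); rewrite mulmx_sumr mulmx_suml summxE; apply: eq_bigr => j _.
rewrite [LHS](_ : _ = ((v *m Phi ^+ k *m M ^+ (m.-1 - j) *m u) *m
  (v *m Phi ^+ j *m u)) 0 0); last by rewrite !mulmxA.
by rewrite mxE big_ord1 mulrC.
Qed.

(** The logarithmic derivative of det(1 - zM) = det(1 - z Phi) (1 - z v (1 - z Phi)^-1 u), obtained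
    here from the cyclicity of the trace. *)
Lemma newton_rank_one :
  newton F (fun m => \tr (M ^+ m.+1) - \tr (Phi ^+ m.+1)).
Proof.
have D m : \tr (M ^+ m.+1) - \tr (Phi ^+ m.+1) = \sum_(k < m.+1) G k (m - k).
  rewrite {1}rank_one_expansion linearD /= addrC addKr raddf_sum /=.
  apply: eq_bigr => k _; rewrite -!mulmxA mxtrace_mulC -!mulmxA mxtrace_mulC.
  by rewrite /mxtrace big_ord1 /G !mulmxA.
move=> m; rewrite D.
(* The leading term of [GE] is [F m] for each of the m + 1 values of k; the remaining sum over k + j
   < m is taken in the other order. *)
under eq_bigr => k _ do rewrite GE subnKC -1?ltnS //.
rewrite big_split /= sumr_const card_ord; congr (_ + _).
rewrite big_ord_recr /= subnn big_ord0 addr0.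
have -> : \sum_(k < m) \sum_(j < m - k) F j * G k ((m - k).-1 - j) =
  \sum_(j < m) \sum_(k < m - j) F j * G k ((m - k).-1 - j).
  exact: (big_triangle m (fun k j => F j * G k ((m - k).-1 - j)%N)).
apply: eq_bigr => j _; rewrite D mulr_sumr; have jm := ltn_ord j.
have -> : (m.-1 - j).+1 = (m - j)%N by lia.
by apply: eq_bigr => k _; congr (_ * G _ _); lia.
Qed.

End RankOne.

(** * Closed walks *)

Lemma coef_prod_linear (R : comNzRingType) (I : finType) (y : I -> R) k :
  (\prod_i (1 + (y i)%:P * 'X))`_k = \sum_(S : {set I} | #|S| == k) \prod_(i in S) y i.
Proof.
under eq_bigr => i _ do rewrite addrC.
rewrite bigA_distr coef_sum [RHS]big_mkcond /=; apply: eq_bigr => S _.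
rewrite -big_mkcond big_split /= prodr_const -rmorph_prod /= mul_polyC coefZ coefXn.
by rewrite eq_sym; case: eqP; rewrite ?mulr1 ?mulr0.
Qed.

(** * The transfer matrix of proper colourings of the cycle *)

Section CyclicTransferMatrix.

Variables (R : idomainType) (N : nat) (x : 'I_N.+1 -> R) (t : R).
Hypothesis t_neq1 : t != 1.

Definition cycle_mx : 'M[R]_N.+1 :=
  \matrix_(i, j) (x j * (if (i < j)%N then t else (j < i)%N%:R)).

(** Blocks of length m + 1: the weight is (t + ... + t^m) e_(m+1), which vanishes for m = 0 since a
    block has at least two letters. *)
Definition block_weight m : R :=
  (\sum_(j < m) t ^+ j.+1) * \sum_(S : {set 'I_N.+1} | #|S| == m.+1) \prod_(i in S) x i.

(** Subtracting x_j throughout column j clears [cycle_mx] below the diagonal and puts -x_i on it, so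
    the traces of the powers of [Phi] are power sums. *)
Let Phi : 'M[R]_N.+1 :=
  \matrix_(i, j) (x j * (if (i < j)%N then t - 1 else - (i == j)%:R)).
Let u : 'cV[R]_N.+1 := const_mx 1.
Let v : 'rV[R]_N.+1 := \row_j x j.

Let cycle_mxE : cycle_mx = Phi + u *m v.
Proof.
apply/matrixP => i j; rewrite !mxE big_ord1 !mxE mul1r -[X in _ + X]mulr1 -mulrDr.
congr (_ * _); rewrite -val_eqE; case: (ltngtP i j) => _; rewrite ?subrK //.
  by rewrite oppr0 add0r.
by rewrite addNr.
Qed.

Let Phi_exp m (i j : 'I_N.+1) : (j <= i)%N -> (Phi ^+ m) i j = (i == j)%:R * (- x i) ^+ m.
Proof.
elim: m i j => [|m IH] i j ji; first by rewrite expr0 mulr1 mxE.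
rewrite exprS -[_ * _]/(_ *m _) mxE (bigD1 i) //= IH // !mxE ltnn eqxx.
rewrite big1 ?addr0 => [|l /negPf li]; first by rewrite mulrN1 exprS mulrCA.
rewrite !mxE; case: ltnP => [il|]; last by rewrite eq_sym li oppr0 mulr0 mul0r.
rewrite IH ?(leq_trans ji (ltnW il)) // -val_eqE /=.
by rewrite gtn_eqF ?(leq_ltn_trans ji il) // mul0r mulr0.
Qed.

Let power_sum m := \sum_i (- x i) ^+ m.+1.

Let tr_Phi m : \tr (Phi ^+ m.+1) = power_sum m.
Proof. by apply: eq_bigr => i _; rewrite Phi_exp // eqxx mul1r. Qed.

Let a i : {poly R} := 1 + (x i)%:P * 'X.
Let b i : {poly R} := 1 + (t * x i)%:P * 'X.
Let E := \prod_i a i.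
(** The column of the g_i is E (1 - z Phi)^-1 u. The c_k turn the factors b_l into a_l one at a
    time, which makes sums over the g_i telescope. *)
Let g i := \prod_(l < N.+1 | (l < i)%N) a l * \prod_(l < N.+1 | (i < l)%N) b l.
Let c k := \prod_(l < N.+1 | (l < k)%N) a l * \prod_(l < N.+1 | (k <= l)%N) b l.

Let c_g (i : 'I_N.+1) : c i = b i * g i.
Proof.
rewrite /c [X in _ * X](bigD1 i) //= mulrCA; congr (_ * (_ * _)).
by apply: eq_bigl => l; rewrite ltn_neqAle andbC eq_sym.
Qed.

Let cS_g (i : 'I_N.+1) : c i.+1 = a i * g i.
Proof.
rewrite /c (bigD1 i) //= -mulrA; congr (_ * (_ * _)).
by apply: eq_bigl => l; rewrite ltnS [RHS]ltn_neqAle andbC.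
Qed.

Let c_step (i : 'I_N.+1) : c i.+1 - c i = - (((t - 1) * x i)%:P * 'X * g i).
Proof.
by rewrite c_g cS_g /a /b mulrBl mul1r polyCB; ring.
Qed.

Let c0 : c 0 = \prod_i b i.
Proof. by rewrite /c big1 ?mul1r // => i; rewrite ltn0. Qed.

Let cN : c N.+1 = E.
Proof.
rewrite /c [X in _ * X]big_pred0 => [|i]; last by rewrite leqNgt ltn_ord.
by rewrite mulr1; apply: eq_bigl => i; rewrite ltn_ord.
Qed.

Let c_sum (k : nat) : (k <= N.+1)%N ->
  \sum_(i < N.+1 | (k <= i)%N) ((t - 1) * x i)%:P * 'X * g i = c k - E.
Proof.
move=> kN; rewrite -[LHS]opprK -sumrN -[RHS]opprB -cN; congr (- _).
under eq_bigr => i _ do rewrite -c_step.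
by rewrite -(telescope_sumr _ kN) big_geq_mkord.
Qed.

Let liftP m n (A : 'M[R]_(m, n)) := map_mx (polyC : R -> {poly R}) A.
Let Z := 'X *: liftP Phi.

(* Solves the triangular system without dividing by t - 1: both sides telescope. *)
Let resolvent : (1 - Z) *m (\col_i g i) = const_mx E.
Proof.
apply/matrixP => i j; rewrite !mxE ord1 {j}.
have -> : \sum_j (1 - Z) i j * (\col_i g i) j 0 =
  g i - \sum_j 'X * (Phi i j)%:P * g j.
  rewrite (eq_bigr (fun j => (i == j)%:R * g j - 'X * (Phi i j)%:P * g j)).
    by rewrite sumrB (bigD1 i) //= eqxx mul1r big1 ?addr0 // => j /negPf;
      rewrite eq_sym => ->; rewrite mul0r.
  by move=> j _; rewrite !mxE mulrBl.
rewrite (bigID (fun j : 'I__ => (i < j)%N)) /= [X in _ - (_ + X)](bigD1 i) ?ltnn //=.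
rewrite [X in _ - (_ + (_ + X))]big1 ?addr0 => [|j /andP [ij ji]]; last first.
  by rewrite mxE (negPf ij) eq_sym (negPf ji) oppr0 mulr0 polyC0 mulr0 mul0r.
rewrite (eq_bigr (fun j => ((t - 1) * x j)%:P * 'X * g j)) => [|j ij]; last first.
  by rewrite mxE ij [x j * _]mulrC; ring.
rewrite c_sum // cS_g mxE ltnn eqxx mulrN1 polyCN /a; ring.
Qed.

Let F k : R := (v *m Phi ^+ k *m u) 0 0.
Let Q := 'X * \sum_i (x i)%:P * g i.

(** The series of [F] is z v (1 - z Phi)^-1 u, which [resolvent] evaluates to Q / E. As S (1 - Z) =
    1 - Z^n, the outer factor z makes the error divisible by z^(n+1). *)
Let F_Q n : eqm n (trunc n F * E) Q.
Proof.
pose v' := liftP v; pose S := \sum_(k < n) Z ^+ k.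
pose u' : 'cV[{poly R}]_N.+1 := const_mx 1; pose uE : 'cV[{poly R}]_N.+1 := const_mx E.
have truncF : trunc n F = 'X * (v' *m S *m u') 0 0.
  apply/polyP => k; rewrite coef_trunc coefXM.
  have -> : (v' *m S *m u') 0 0 = \poly_(j < n) F j.
    rewrite poly_def mulmx_sumr mulmx_suml summxE; apply: eq_bigr => j _.
    rewrite -mul_polyC /Z exprZn -scalemxAr -scalemxAl mxE mulrC; congr (_ * _).
    have <- : liftP u = u' by rewrite /liftP map_const_mx polyC1.
    by rewrite -rmorphXn /= -!map_mxM mxE.
  by rewrite coef_poly; case: k => [|k]; rewrite ?if_same ?ltnS.
have -> : trunc n F * E = 'X * (v' *m (1 - Z ^+ n) *m \col_i g i) 0 0.
  rewrite truncF -mulrA; congr (_ * _).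
  have -> : (v' *m S *m u') 0 0 * E = (v' *m S *m uE) 0 0.
    by rewrite !mxE mulr_suml; apply: eq_bigr => i _; rewrite !mxE mulr1.
  rewrite /uE -resolvent -!mulmxA; congr ((_ *m _) 0 0); rewrite !mulmxA.
  congr (_ *m _); rewrite -[1 - Z ^+ n]opprB subrX1 -mulNr opprB.
  rewrite -[LHS]/(S * _); apply/esym/commr_sum => k _.
  by apply/commrX/commr_sym/commrB => //; apply: commr1.
have -> : 'X * (v' *m (1 - Z ^+ n) *m \col_i g i) 0 0 =
   Q - 'X^(n.+1) * (v' *m liftP (Phi ^+ n) *m \col_i g i) 0 0.
  rewrite mulmxBr mulmxBl mulmx1 mxE [X in _ + X]mxE mulrDr; congr (_ + _).
    by congr (_ * _); rewrite mxE; apply: eq_bigr => i _; rewrite !mxE.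
  rewrite mulrN exprS -mulrA; congr (- (_ * _)).
  rewrite /Z exprZn -scalemxAr -scalemxAl mxE; congr (_ * _).
  by rewrite /liftP rmorphXn.
by move=> k kn; rewrite coefB coefXnM ltnS kn subr0.
Qed.

Let W := block_weight.

(** [c_sum] at k = 0 gives (t - 1) Q_k = (t^k - 1) e_k. Cancelling t - 1, nonzero in a domain,
    leaves Q_k = (1 + ... + t^(k-1)) e_k, whose first term cancels against E. *)
Let EQ_W n : eqm n (E - Q) (1 - trunc n W).
Proof.
have eE k : E`_k = \sum_(S : {set 'I_N.+1} | #|S| == k) \prod_(i in S) x i.
  exact: coef_prod_linear.
have bE k : (\prod_i b i)`_k = t ^+ k * E`_k.
  rewrite coef_prod_linear eE mulr_sumr; apply: eq_bigr => S /eqP <-.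
  by rewrite big_split /= prodr_const.
have tQ : (t - 1)%:P * Q = \prod_i b i - E.
  rewrite -c0 -c_sum // /Q !mulr_sumr; apply: eq_big => // i _.
  by rewrite polyCM; ring.
have QE k : Q`_k = (\sum_(j < k) t ^+ j) * E`_k.
  have : (t - 1) * Q`_k = (t - 1) * ((\sum_(j < k) t ^+ j) * E`_k).
    by rewrite mulrA -subrX1 [RHS]mulrBl mul1r -bE -coefB -tQ coefCM.
  by apply: mulfI; rewrite subr_eq0.
move=> k kn; rewrite !coefB QE coef_trunc ltnS kn coef1.
case: k kn => [|k] kn.
  rewrite big_ord0 mul0r eE (big_pred1 set0) ?big_set0 // => S.
  by rewrite cards_eq0.
by rewrite /W /block_weight -eE big_ord_recl expr0 mulrDl mul1r opprD addNKr sub0r.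
Qed.

(** Newton's identities: the geometric series of -x_i sums to -x_i z / (1 + x_i z), and the Leibniz
    rule collects these over the factors of [E]. *)
Let power_sum_E n : eqm n (trunc n power_sum * E) (- ('X * E^`())).
Proof.
pose h i := trunc n (fun k => (- x i) ^+ k.+1).
have ha i : eqm n (h i * a i) (- ('X * (a i)^`())).
  have -> : (a i)^`() = (x i)%:P.
    by rewrite derivD derivM !derivC derivX mul0r !add0r mulr1.
  move=> k kn; rewrite /a mulrDr mulr1 mulrCA mul_polyC coefN coefXM coefD coefZ coefMX.
  rewrite coefC !coef_trunc ltnS kn.
  case: k kn => [|[|k]] kn /=; rewrite ?mulr0 ?addr0 ?oppr0 ?expr1 //.
  by rewrite ltnW // exprS mulNr addNr.
have -> : trunc n power_sum = \sum_i h i.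
  apply/polyP => -[|k]; rewrite coef_sum coef_trunc.
    by rewrite big1 ?if_same // => i _; rewrite coef_trunc.
  case: ifP => kn; last by rewrite big1 // => i _; rewrite coef_trunc kn.
  by apply: eq_bigr => i _; rewrite coef_trunc kn.
rewrite /E; elim: (index_enum _) => [|i s IH].
  by rewrite !big_nil mul0r derivC mulr0 oppr0 => k.
rewrite !big_cons; move: (\sum_(j <- s) h j) (\prod_(j <- s) a j) IH => H P IH.
have -> : (h i + H) * (a i * P) = h i * a i * P + H * P * a i by ring.
have -> : - ('X * (a i * P)^`()) = - ('X * (a i)^`()) * P + - ('X * P^`()) * a i.
  by rewrite derivM; ring.
by apply: eqmD; apply: eqmMr.
Qed.

(** Since 1 - W = (1 - F) E, logarithmic derivatives add: the rank-one part supplies that of 1 - F,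
    the traces of [Phi] that of [E]. *)
Lemma newton_cycle_mx : newton W (fun m => \tr (cycle_mx ^+ m.+1)).
Proof.
apply/newton_trunc => n.
have D : eqm n (trunc n (fun m => \tr (cycle_mx ^+ m.+1) - power_sum m)
                 * (1 - trunc n F)) ('X * (trunc n F)^`()).
  move: n; apply/newton_trunc => m.
  have := newton_rank_one Phi u v m; rewrite -cycle_mxE tr_Phi => ->.
  by congr (_ + _); apply: eq_bigr => j _; rewrite tr_Phi.
have -> : trunc n (fun m => \tr (cycle_mx ^+ m.+1)) =
  trunc n (fun m => \tr (cycle_mx ^+ m.+1) - power_sum m) + trunc n power_sum.
  apply/polyP => -[|k]; rewrite coefD !coef_trunc ?addr0 //.
  by case: ifP; rewrite ?addr0 ?subrK.
move: (trunc n (fun m => \tr (cycle_mx ^+ m.+1) - power_sum m)) D => D' D.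
have FW : eqm n ((1 - trunc n F) * E) (1 - trunc n W).
  refine (eqm_trans _ (@EQ_W n)); rewrite mulrBl mul1r.
  by apply: eqmD => //; apply/eqmN/F_Q.
apply: eqm_trans (eqmM (fun _ _ => erefl) (eqm_sym FW)) _.
rewrite mulrA mulrDl mulrDl.
apply: eqm_trans (_ : eqm n _ ('X * (trunc n F)^`() * E - ('X * E^`()) * (1 - trunc n F))) _.
  apply: eqmD; first exact: eqmMr.
  by rewrite mulrAC -mulNr; apply/eqmMr/power_sum_E.
have -> : 'X * (trunc n W)^`() = - ('X * (1 - trunc n W)^`()).
  by rewrite derivB derivC sub0r mulrN opprK.
rewrite [X in eqm _ X](_ : _ = - ('X * ((1 - trunc n F) * E)^`())).
  exact/eqmN/eqm_deriv.
by rewrite derivM derivB derivC sub0r; ring.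
Qed.

End CyclicTransferMatrix.

(** * Binary words cut at their falls *)

Lemma big_tuple0 (V : nmodType) (T : finType) (F : seq T -> V) :
  \sum_(b : 0.-tuple T) F b = F [::].
Proof. by rewrite (big_pred1 [tuple]) // => b; exact/esym/eqP/tuple0. Qed.

Lemma big_tupleS (V : nmodType) (T : finType) n (F : seq T -> V) :
  \sum_(b : n.+1.-tuple T) F b = \sum_(y : T) \sum_(b : n.-tuple T) F (y :: b).
Proof.
rewrite pair_big /=.
rewrite (reindex (fun p : T * n.-tuple T => cons_tuple p.1 p.2)) //=.
exists (fun b => (thead b, [tuple of behead b])) => [[y b]|b] _ /=.
  by congr (_, _); apply/val_inj.
by rewrite [RHS](tuple_eta b).
Qed.

Lemma big_ffun_tuple (V : nmodType) (T : finType) n (F : seq T -> V) :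
  \sum_(f : {ffun 'I_n -> T}) F [seq f i | i <- enum 'I_n] =
  \sum_(b : n.-tuple T) F b.
Proof.
rewrite (reindex (fun b : n.-tuple T => [ffun i => tnth b i])) /=.
  apply: eq_bigr => b _; congr F; rewrite -[RHS]map_tnth_enum.
  by apply: eq_map => i; rewrite ffunE.
exists (fun f : {ffun 'I_n -> T} => [tuple f i | i < n]) => [b|f] _.
  by apply: eq_from_tnth => i; rewrite tnth_mktuple ffunE.
by apply/ffunP => i; rewrite ffunE tnth_mktuple.
Qed.

Definition diffs (l : nat) (s : seq nat) : seq nat := pairmap (fun u v => v - u)%N l s.

(** The last gap runs across the end of the word, up to [n + h], the first entry one turn later. *)
Definition cyclic_gaps n (s : seq nat) : seq nat :=
  if s is h :: s' then diffs h (rcons s' (n + h)%N) else [::].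

(** With the last letter of [b] as [prev] the word is read cyclically, and its falls are the sinks
    of the orientation it encodes. *)
Fixpoint falls (prev : bool) (p : nat) (b : seq bool) : seq nat :=
  if b is y :: b' then
    if prev && ~~ y then p :: falls y p.+1 b' else falls y p.+1 b'
  else [::].

Section Words.

Variables (R : comNzRingType) (t : R) (e : nat -> R).

(** A word without a fall is constant and comes from no acyclic orientation, hence the weight 0. *)
Definition word_weight (b : seq bool) : R :=
  t ^+ count id b *
  (if falls (last false b) 0 b is [::] then 0
   else \prod_(d <- cyclic_gaps (size b) (falls (last false b) 0 b)) e d).

(* Reading b from a position where the last fall lies c steps back, the first
   fall was at s0, and the whole word has to end with x. *)
Fixpoint tail_weight (x : bool) (s0 : nat) (prev : bool) (c : nat) (b : seq bool) : R :=
  if b is y :: b' then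
    if prev && ~~ y then e c * tail_weight x s0 false 1 b' else t ^+ y * tail_weight x s0 y c.+1 b'
  else (prev == x)%:R * e (c + s0)%N.

(** The phase before the first fall: [s0] counts the letters read and so becomes the position of
    that fall. *)
Fixpoint head_weight (x : bool) (s0 : nat) (prev : bool) (b : seq bool) : R :=
  if b is y :: b' then
    if prev && ~~ y then tail_weight x s0 false 1 b' else t ^+ y * head_weight x s0.+1 y b'
  else 0.

(** Only differences of positions matter, so the position [l] of the last fall is free; the
    induction moves it to [l + c] at a fall. *)
Lemma tail_weightE x s0 prev l c b :
  tail_weight x s0 prev c b = (last prev b == x)%:R * t ^+ count id b *
  \prod_(d <- diffs l (rcons (falls prev (l + c) b) (l + c + size b + s0)%N)) e d.
Proof.
elim: b prev l c => [|y b IH] prev l c /=.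
  by rewrite big_seq1 expr0 mulr1 addn0; congr (_ * e _); lia.
case: ifP => [/andP [_ /negPf ->]|_].
  by rewrite (IH _ (l + c)%N) /= big_cons addn1 add0n addSnnS addKn mulrCA.
by rewrite (IH _ l) addnS addSnnS exprD !mulrA [t ^+ y * _]mulrC.
Qed.

Lemma head_weightE x s0 prev b :
  head_weight x s0 prev b = (last prev b == x)%:R * t ^+ count id b *
  (if falls prev s0 b is [::] then 0
   else \prod_(d <- cyclic_gaps (s0 + size b) (falls prev s0 b)) e d).
Proof.
elim: b prev s0 => [|y b IH] prev s0 /=; first by rewrite mulr0.
case: ifP => [/andP [_ /negPf ->]|_].
  by rewrite (tail_weightE _ _ _ s0) addn1 addSnnS add0n.
by rewrite IH addSnnS exprD !mulrA [t ^+ y * _]mulrC.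
Qed.

(** The letter preceding the first one is the last one: it is guessed as [x], and a wrong guess
    gives 0 at the end of the word. *)
Lemma word_weightE b : word_weight b = \sum_(x : bool) head_weight x 0 x b.
Proof.
case: b => [|y b]; first by rewrite big1 // /word_weight mulr0.
rewrite (bigD1 (last y b)) //= [X in _ + X]big1 ?addr0 => [|x xn].
  by rewrite -[RHS]/(head_weight (last y b) 0 (last y b) (y :: b)) head_weightE eqxx mul1r.
by rewrite -[LHS]/(head_weight x 0 x (y :: b)) head_weightE /= eq_sym (negPf xn) !mul0r.
Qed.

Let L x s0 prev c m := \sum_(b : m.-tuple bool) tail_weight x s0 prev c b.
Let C x s0 prev m := \sum_(b : m.-tuple bool) head_weight x s0 prev b.
(** The total weight of the words 0^p 1^q with p + q = m and q > 0. *)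
Let T m := \sum_(j < m) t ^+ j.+1.

Let TSr m : T m.+1 = T m + t ^+ m.+1.
Proof. by rewrite /T big_ord_recr. Qed.

(** In 0^p 1^q, either a 1 occurs among the first m letters and s ones follow, or these m letters
    are all 0. *)
Let TD s m : T (m + s) = t ^+ s * T m + T s.
Proof.
elim: m => [|m IH]; first by rewrite /T big_ord0 mulr0 add0r.
by rewrite addSn !TSr IH -addSn addnC exprD; ring.
Qed.

Let L_trueS x s0 c m :
  L x s0 true c m.+1 = t * L x s0 true c.+1 m + e c * L x s0 false 1 m.
Proof. by rewrite /L big_tupleS big_bool /= -!mulr_sumr expr1. Qed.

Let L_falseS x s0 c m :
  L x s0 false c m.+1 = t * L x s0 true c.+1 m + L x s0 false c.+1 m.
Proof. by rewrite /L big_tupleS big_bool /= -!mulr_sumr expr1 expr0 mul1r. Qed.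

Let C_trueS x s0 m :
  C x s0 true m.+1 = t * C x s0.+1 true m + L x s0 false 1 m.
Proof. by rewrite /C big_tupleS big_bool /= -!mulr_sumr expr1. Qed.

Let C_falseS x s0 m :
  C x s0 false m.+1 = t * C x s0.+1 true m + C x s0.+1 false m.
Proof. by rewrite /C big_tupleS big_bool /= -!mulr_sumr expr1 expr0 mul1r. Qed.

(** After a 1 the next fall comes after i more ones; with no further fall only ones follow. *)
Let L_true x s0 c m : L x s0 true c m = t ^+ m * x%:R * e (c + m + s0)%N
  + \sum_(i < m) t ^+ i * e (c + i)%N * L x s0 false 1 (m.-1 - i).
Proof.
elim: m c => [|m IH] c.
  by rewrite /L big_tuple0 big_ord0 /= addr0 expr0 mul1r addn0; case: x.
rewrite L_trueS IH big_ord_recl expr0 mul1r addn0 subn0 mulrDr addrAC -addrA addSnnS.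
rewrite !mulrA -exprS; congr (_ + (_ + _)).
rewrite mulr_sumr; apply: eq_bigr => i _; rewrite !lift0 /= addSnnS exprS.
have -> : (m - i.+1 = m.-1 - i)%N by lia.
by rewrite !mulrA.
Qed.

(** After a 0 the i letters before the next fall are 0^p 1^q with q > 0, of weight [T i]. With no
    further fall the rest is 0^m if x = 0, and 0^p 1^q with q > 0 if x = 1. *)
Let L_false x s0 c m : L x s0 false c m = ((~~ x)%:R + x%:R * T m) * e (c + m + s0)%N
  + \sum_(i < m) T i * e (c + i)%N * L x s0 false 1 (m.-1 - i).
Proof.
elim: m c => [|m IH] c.
  rewrite /L big_tuple0 big_ord0 /= addr0 /T big_ord0 mulr0 addr0 addn0.
  by case: x.
rewrite L_falseS L_true IH.
rewrite [\sum_(i < m.+1) _]big_ord_recl {4}/T big_ord0 !mul0r add0r addSnnS.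
set X := e _; rewrite (_ : \sum_(i < m) T (bump 0 i) * _ * _ =
  t * (\sum_(i < m) t ^+ i * e (c.+1 + i)%N * L x s0 false 1 (m.-1 - i)) +
  \sum_(i < m) T i * e (c.+1 + i)%N * L x s0 false 1 (m.-1 - i)).
  by rewrite TSr exprS; ring.
rewrite mulr_sumr -big_split; apply: eq_bigr => i _.
rewrite !lift0 /= addSnnS TSr exprS.
have -> : (m - i.+1 = m.-1 - i)%N by lia.
by ring.
Qed.

Let C_true x s0 m :
  C x s0 true m = \sum_(i < m) t ^+ i * L x (s0 + i) false 1 (m.-1 - i).
Proof.
elim: m s0 => [|m IH] s0; first by rewrite /C big_tuple0 big_ord0.
rewrite C_trueS IH.
rewrite big_ord_recl expr0 mul1r addn0 subn0 addrC; congr (_ + _).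
rewrite mulr_sumr; apply: eq_bigr => i _; rewrite !lift0 /= addSnnS exprS.
have -> : (m - i.+1 = m.-1 - i)%N by lia.
by rewrite !mulrA.
Qed.

Let C_false x s0 m :
  C x s0 false m = \sum_(i < m) T i * L x (s0 + i) false 1 (m.-1 - i).
Proof.
elim: m s0 => [|m IH] s0; first by rewrite /C big_tuple0 big_ord0.
rewrite C_falseS IH C_true.
rewrite big_ord_recl {2}/T big_ord0 mul0r add0r mulr_sumr -big_split.
apply: eq_bigr => i _; rewrite !lift0 /= addSnnS TSr exprS.
have -> : (m - i.+1 = m.-1 - i)%N by lia.
by ring.
Qed.

Lemma newton_words :
  newton (fun m => (\sum_(j < m) t ^+ j.+1) * e m.+1)
         (fun m => \sum_(b : m.+1.-tuple bool) word_weight b).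
Proof.
(* Words with first fall at s and m letters after it. The s letters before it are 1^s if the word
   ends in 1, and 0^p 1^q with q > 0 if it ends in 0. *)
pose A s m := t ^+ s * L true s false 1 m + T s * L false s false 1 m.
(* Either the fall is the only one, and [TD] glues both ends of the word into one block, or the
   block of length i + 1 starting at the first fall is cut out. *)
have AE s m : A s m = T (m + s) * e (m + s).+1 +
    \sum_(i < m) (T i * e i.+1) * A s (m.-1 - i)%N.
  rewrite /A !L_false /= !add1n TD.
  have -> : \sum_(i < m) T i * e i.+1 *
      (t ^+ s * L true s false 1 (m.-1 - i) + T s * L false s false 1 (m.-1 - i)) =
    t ^+ s * (\sum_(i < m) T i * e (1 + i)%N * L true s false 1 (m.-1 - i)) +
    T s * (\sum_(i < m) T i * e (1 + i)%N * L false s false 1 (m.-1 - i)).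
    rewrite !mulr_sumr -big_split; apply: eq_bigr => i _; rewrite add1n /=; ring.
  by rewrite addSn; ring.
have QE m : \sum_(b : m.+1.-tuple bool) word_weight b = \sum_(s < m.+1) A s (m - s)%N.
  under eq_bigr => b _ do rewrite word_weightE.
  rewrite exchange_big big_bool /= -[X in X + _]/(C true 0 true m.+1).
  rewrite -[X in _ + X]/(C false 0 false m.+1) C_true C_false -big_split.
  by apply: eq_bigr => i _ /=; rewrite add0n.
move=> m; rewrite QE.
under eq_bigr => s _ do rewrite AE subnK -1?ltnS //.
rewrite big_split /= sumr_const card_ord; congr (_ + _).
rewrite big_ord_recr /= subnn big_ord0 addr0.
rewrite (big_triangle m (fun k j => (T j * e j.+1) * A k ((m - k).-1 - j)%N)).
apply: eq_bigr => j _; rewrite QE mulr_sumr; have jm := ltn_ord j.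
have -> : (m.-1 - j).+1 = (m - j)%N by lia.
by apply: eq_bigr => k _; congr (_ * A _ _); lia.
Qed.

End Words.

(** * Traces of matrix powers as sums over closed walks *)

Section ClosedWalks.

Variables (R : comNzRingType) (N : nat) (M : 'M[R]_N.+1).

Fixpoint walk_weight (i : 'I_N.+1) (s : seq 'I_N.+1) (j : 'I_N.+1) : R :=
  if s is k :: s' then M i k * walk_weight k s' j else M i j.

Lemma expmx_walks m i j :
  (M ^+ m.+1) i j = \sum_(s : m.-tuple 'I_N.+1) walk_weight i s j.
Proof.
elim: m i => [|m IH] i; first by rewrite (big_tuple0 (fun s => walk_weight i s j)).
rewrite (big_tupleS m (fun s => walk_weight i s j)) exprS -[_ * _]/(_ *m _) mxE; apply: eq_bigr => k _.
by rewrite IH mulr_sumr.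
Qed.

Lemma tr_expmx m : \tr (M ^+ m.+1) =
  \sum_(k : {ffun 'I_m.+1 -> 'I_N.+1}) \prod_i M (k i) (k (ordS i)).
Proof.
pose F (s : seq 'I_N.+1) := if s is i :: s' then walk_weight i s' i else 0.
rewrite /mxtrace; under eq_bigr => i _ do rewrite expmx_walks.
rewrite -(big_tupleS m F) -big_ffun_tuple; apply: eq_bigr => k _.
rewrite /F; case E : [seq k i | i <- enum 'I_m.+1] => [|i s].
  by have := congr1 size E; rewrite size_map size_enum_ord.
(* Step l of the walk leads from entry l of [i0 :: s0] to entry l of the shifted list
   [rcons s0 j]. *)
have walkE i0 s0 j : walk_weight i0 s0 j =
    \prod_(l < (size s0).+1) M (nth i (i0 :: s0) l) (nth i (rcons s0 j) l).
  elim: s0 i0 => [|k0 s0 IH] i0 /=; first by rewrite big_ord1.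
  by rewrite IH [RHS]big_ord_recl.
have sz : size s = m by have := congr1 size E; rewrite size_map size_enum_ord => -[].
have nthE (l : 'I_m.+1) : nth i (i :: s) l = k l.
  by rewrite -E (nth_map ord0) ?size_enum_ord ?nth_ord_enum.
rewrite walkE sz; apply: eq_bigr => l _; rewrite nthE; congr (M _ _).
rewrite -nthE nth_rcons sz /=; case: (ltngtP l m) => [lm|ml|lm].
- by rewrite modn_small.
- by have := ltn_ord l; rewrite ltnS leqNgt ml.
- by rewrite lm modnn.
Qed.

End ClosedWalks.

(** * Acyclic orientations of the cycle *)

Lemma diffs_gt0 l s : path ltn l s -> all (leq 1) (diffs l s).
Proof. by elim: s l => //= k s IH l /andP [lk /IH ->]; rewrite subn_gt0 lk. Qed.

Lemma sumn_diffs l s : path ltn l s -> (sumn (diffs l s) = last l s - l)%N.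
Proof.
elim: s l => [|k s IH] l /=; first by rewrite subnn.
case/andP => lk ps; rewrite IH //.
have: (k <= last k s)%N.
  by elim: s k ps {lk IH} => //= j s IH k /andP [/ltnW kj /IH]; apply: leq_trans.
lia.
Qed.

Lemma path_cyclic_gaps n h s : (0 < n)%N -> path ltn h s -> all (gtn n) s ->
  path ltn h (rcons s (n + h)%N).
Proof.
move=> n0; rewrite rcons_path => -> /= /allP sn.
have := mem_last h s; rewrite inE => /orP [/eqP ->|/sn /=]; lia.
Qed.

Lemma next_pairmap (T : eqType) (U : Type) (F : T -> T -> U) h s :
  uniq (h :: s) ->
  [seq F i (next (h :: s) i) | i <- h :: s] = pairmap F h (rcons s h).
Proof.
move=> us; apply: (@eq_from_nth _ (F h h)).
  by rewrite size_map size_pairmap size_rcons.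
move=> i; rewrite size_map => i_s; rewrite (nth_map h) // (nth_pairmap h); last first.
  by rewrite size_rcons.
rewrite next_nth mem_nth // index_uniq //; congr F.
  move: i_s; rewrite /= ltnS leq_eqVlt => /orP [/eqP -> | i_s].
    by rewrite -rcons_cons nth_rcons /= ltnSn.
  by rewrite -rcons_cons nth_rcons /= ltnS (ltnW i_s).
by rewrite nth_rcons_default.
Qed.

(** Inner gaps exceed their value by n before the reduction in [between]; the closing gap, back to h
    <= l, is already below n, and is n - 1 when h = l. *)
Lemma between_diffs n (h l : 'I_n) (s : seq 'I_n) :
  (h <= l)%N -> path (fun i j : 'I_n => (i < j)%N) l s ->
  pairmap (@between n) l (rcons s h) =
  [seq k.-1 | k <- diffs l (rcons [seq val i | i <- s] (n + h)%N)].
Proof.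
elim: s l => [|k s IH] l hl /=.
  move=> _; congr [:: _]; rewrite /between addnC modn_small //.
  have := ltn_ord l; lia.
case/andP => lk ps; rewrite IH ?(leq_trans hl (ltnW lk)) //; congr (_ :: _).
rewrite /between; have kn := ltn_ord k.
have -> : ((k + n - l).-1 = (k - l).-1 + n)%N by lia.
rewrite modnDr modn_small //; lia.
Qed.

Section Orientations.

Variable m : nat.
Local Notation n := m.+2.
Implicit Types (a : {set 'I_n * 'I_n}) (f : {ffun 'I_n -> bool}).

Definition orientation_word a : {ffun 'I_n -> bool} := [ffun i => (i, ordS i) \in a].

Definition word_orientation f : {set 'I_n * 'I_n} :=
  [set p | (p.2 == ordS p.1) && f p.1 || (p.1 == ordS p.2) && ~~ f p.2].

Lemma orientationP a :
  reflect [/\ forall u v, (u, v) \in a -> v = ordS u \/ u = ordS v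
            & forall u, ((ordS u, u) \in a) = ~~ ((u, ordS u) \in a)]
          (orientation (@dcycle n) a).
Proof.
apply: (iffP forallP) => [H | [H1 H2] u].
  split=> [u v uv | u].
    have /forallP/(_ v) := H u; rewrite /adjacent /dcycle /= uv.
    by case: ifP => // /orP [/eqP|/eqP]; [left|right].
  have /forallP/(_ (ordS u)) := H u; rewrite /adjacent /dcycle /= eqxx /=.
  by case: (_ \in a); case: (_ \in a).
apply/forallP => v; rewrite /adjacent /dcycle /=; case: ifP => [/orP [/eqP ->|/eqP ->]|].
- by rewrite H2; case: (_ \in a).
- by rewrite H2; case: (_ \in a).
by move=> /negbT; apply: contra => /H1 [->|->]; rewrite eqxx ?orbT.
Qed.

Lemma sink_word a u : orientation (@dcycle n) a ->
  sink a (ordS u) = orientation_word a u && ~~ orientation_word a (ordS u).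
Proof.
case/orientationP => H1 H2; rewrite !ffunE -[RHS]negbK negb_and negbK -H2 /sink.
apply/forallP/norP => [H|[/negPf h1 /negPf h2] w]; first by rewrite !H.
by apply/negP => h; have [E|/ordS_inj E] := H1 _ _ h; move: h; rewrite E ?h1 ?h2 // -E h1.
Qed.

(** Iterating [ordS] from [x] reaches every vertex. *)
Lemma ordS_closed (C : pred 'I_n) x v :
  (forall y, C y -> C (ordS y)) -> C x -> C v.
Proof.
move=> Cs Cx.
have iterE k : val (iter k (@ordS n) x) = ((x + k) %% n)%N.
  elim: k => [|k IH]; first by rewrite addn0 modn_small.
  by rewrite iterS /= IH -addn1 modnDml addn1 addnS.
have -> : v = iter (v + n - x) (@ordS n) x.
  apply/val_inj; rewrite iterE subnKC; last first.
    by rewrite (leq_trans (ltnW (ltn_ord x))) ?leq_addl.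
  by rewrite modnDr modn_small.
by elim: (v + n - x)%N => //= k /Cs.
Qed.

Lemma ord_pred_closed (C : pred 'I_n) x v :
  (forall y, C y -> C (ord_pred y)) -> C x -> C v.
Proof.
move=> Cp Cx; pose D := [pred y | ~~ C y].
apply: contraLR Cx => Cv; rewrite -/(D x).
apply: (@ordS_closed D v) => // y /=; apply: contra => /Cp.
by rewrite ordSK.
Qed.

(** A directed cycle cannot turn back, as this would use both arcs of one edge. It therefore keeps
    its direction and visits every vertex, including the sink, which has no outgoing arc. *)
Lemma acyclic_sink a v : orientation (@dcycle n) a -> sink a v -> acyclic a.
Proof.
case/orientationP => H1 H2 /forallP sv; apply/existsP => -[[c /= _]] /andP [].
case: c => [|x c] //; move: (x :: c) (mem_head x c) => p xp _ /andP [cyc _].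
have arc y : y \in p -> (y, next p y) \in a by apply: (next_cycle cyc).
have not_v : v \notin p by apply/negP => /arc; apply/negP/sv.
have [E|E] := H1 _ _ (arc _ xp).
  suff: (v \in p) && (next p v == ordS v) by rewrite (negPf not_v).
  apply: (@ordS_closed [pred y | (y \in p) && (next p y == ordS y)] x) => /=.
    move=> y /andP [yp /eqP ny]; have Syp : ordS y \in p by rewrite -ny mem_next.
    rewrite Syp /=; have [->//|/ordS_inj E'] := H1 _ _ (arc _ Syp).
    by have := arc _ Syp; rewrite -E' H2 -ny arc.
  by rewrite xp E eqxx.
suff: (v \in p) && (next p v == ord_pred v) by rewrite (negPf not_v).
apply: (@ord_pred_closed [pred y | (y \in p) && (next p y == ord_pred y)] x) => /=.
  move=> y /andP [yp /eqP ny]; have Pyp : ord_pred y \in p by rewrite -ny mem_next.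
  rewrite Pyp /=; have [E'|{2}->] := H1 _ _ (arc _ Pyp); last by rewrite ordSK.
  have := arc _ yp; rewrite ny -{1}[y]ord_predK H2 => /negP [].
  by rewrite -E' arc.
by rewrite xp {2}E ordSK eqxx.
Qed.

Lemma asc_orientation_word a : orientation (@dcycle n) a ->
  asc_orientation (@dcycle n) a = count id [seq orientation_word a i | i <- enum 'I_n].
Proof.
move=> /orientationP [H1 H2]; rewrite /asc_orientation count_map -size_filter.
rewrite -[RHS](size_map (fun i : 'I_n => (i, ordS i))) cardE; apply/perm_size.
apply: uniq_perm; first exact: enum_uniq.
  by rewrite map_inj_uniq => [|i j []//]; apply/filter_uniq/enum_uniq.
move=> [u v]; rewrite mem_enum inE /=; apply/andP/mapP => [[uv /eqP E]|[i]].
  by exists u; rewrite ?E // mem_filter mem_enum /= ffunE -E uv.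
by rewrite mem_filter /= ffunE => /andP [ia _] [-> ->]; split=> //; apply: eqxx.
Qed.

Lemma orientation_wordK a : orientation (@dcycle n) a ->
  word_orientation (orientation_word a) = a.
Proof.
move=> /orientationP [H1 H2]; apply/setP => -[u v]; rewrite inE /= !ffunE.
apply/idP/idP => [/orP [/andP [/eqP -> //]|/andP [/eqP ->]]|uv].
  by rewrite -H2.
by have [E|E] := H1 _ _ uv; move: uv; rewrite E eqxx ?H2 => -> //; rewrite orbT.
Qed.

(* Only concerns n = 2, where both arcs of the digraph join the same two vertices. *)
Lemma has_fall_two_step f u i :
  f u -> ~~ f (ordS u) -> ordS (ordS i) = i -> f (ordS i) = ~~ f i.
Proof.
move=> fu /negPf fSu SSi.
suff: (u == i) || (u == ordS i).
  by case/orP => /eqP E; move: fu fSu; rewrite E ?SSi => -> ->.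
apply: (@ordS_closed [pred u | (u == i) || (u == ordS i)] i) => /= [y|].
  by case/orP => /eqP ->; rewrite ?SSi eqxx ?orbT.
by rewrite eqxx.
Qed.

Lemma word_orientationK f u : f u -> ~~ f (ordS u) ->
  orientation_word (word_orientation f) = f.
Proof.
move=> fu fSu; apply/ffunP => i; rewrite !ffunE inE /= eqxx /=.
by case: eqP => [/esym /(has_fall_two_step fu fSu) ->|]; rewrite ?negbK ?orbb ?orbF.
Qed.

Lemma word_orientationP f u : f u -> ~~ f (ordS u) ->
  orientation (@dcycle n) (word_orientation f).
Proof.
move=> fu fSu; apply/orientationP; split=> [x y|x].
  by rewrite inE /= => /orP [] /andP [/eqP ->]; [left|right].
rewrite !inE /= !eqxx /=.
by case: eqP => [/esym /(has_fall_two_step fu fSu) ->|] /=; case: (f x).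
Qed.

Lemma falls_filter d prev p b : falls prev p b =
  [seq (p + i)%N | i <- iota 0 (size b) & nth d (prev :: b) i && ~~ nth d b i].
Proof.
elim: b prev p => [|y b IH] prev p //=; rewrite (iotaDl 1 0) filter_map IH.
by case: ifP => _ /=; rewrite ?addn0 -map_comp; [congr (_ :: _)|];
  apply: eq_map => i /=; rewrite addSnnS.
Qed.

Lemma falls_word f (b := [seq f i | i <- enum 'I_n]) : falls (last false b) 0 b =
  [seq val v | v <- enum 'I_n & f (ord_pred v) && ~~ f v].
Proof.
have nthE (v : 'I_n) : nth false b v = f v.
  by rewrite (nth_map ord0) ?nth_ord_enum // size_enum_ord.
rewrite (falls_filter false) size_map size_enum_ord map_id -val_enum_ord filter_map.
congr (map _ _); apply: eq_filter => v /=; rewrite nthE; congr (_ && _).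
(* At position 0 the preceding letter is the last one of [b], which is the letter of
   [ord_pred v]. *)
case E : (nat_of_ord v) => [|k] /=; last first.
  have -> : k = ord_pred v :> nat.
    by rewrite /= E /= modnDr modn_small // -E ltnW.
  exact: nthE.
rewrite -nth_last size_map size_enum_ord -[X in nth _ _ X](_ : ord_pred v = m.+1 :> nat).
  exact: nthE.
by rewrite /= E modn_small.
Qed.

Lemma falls_sinks a : orientation (@dcycle n) a ->
  let b := [seq orientation_word a i | i <- enum 'I_n] in
  falls (last false b) 0 b = [seq val v | v <- enum (sink a)].
Proof.
move=> oa b; rewrite falls_word [enum (sink a)]/enum_mem -enumT; congr (map _ _).
apply: eq_filter => v; have := sink_word (ord_pred v) oa.
by rewrite ord_predK => <-.
Qed.

Lemma sorted_sinks a : sorted (relpre val ltn) (enum (sink a)).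
Proof.
rewrite [enum _]/enum_mem -enumT; apply: sorted_filter.
  by move=> x y z; apply: ltn_trans.
by rewrite -sorted_map val_enum_ord iota_ltn_sorted.
Qed.

Definition gaps a := cyclic_gaps n [seq val v | v <- enum (sink a)].

Lemma gapsP a v : sink a v -> [/\ sink_gaps a = [seq k.-1 | k <- gaps a],
  all (leq 1) (gaps a) & sumn (gaps a) = n].
Proof.
move=> av; rewrite /sink_gaps /gaps; have: v \in enum (sink a) by rewrite mem_enum.
case: (enum _) (enum_uniq (sink a)) (sorted_sinks a) => // h s us hs _.
have ps : path ltn h (rcons [seq val i | i <- s] (n + h)%N).
  apply: path_cyclic_gaps; rewrite // ?path_map //.
  by apply/allP => _ /mapP [i _ ->]; apply: ltn_ord.
split; first by rewrite next_pairmap // between_diffs.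
  exact: diffs_gt0.
by rewrite sumn_diffs // last_rcons addnK.
Qed.

(** Each orientation with a sink lies in [AO la] for exactly one [la], its sorted gaps. These
    orientations correspond to the words with a fall, and the other words have weight 0. *)
Lemma sum_AO_words (R : comNzRingType) (t : R) (e : nat -> R) :
  \sum_(la : intpart n) (\sum_(a in AO la) t ^+ asc_orientation (@dcycle n) a) *
     \prod_(k <- la) e k
  = \sum_(b : n.-tuple bool) word_weight t e b.
Proof.
pose P a := orientation (@dcycle n) a && [exists v, sink a v].
pose G a := t ^+ asc_orientation (@dcycle n) a * \prod_(d <- gaps a) e d.
(* Without a sink the list of gaps, hence [la], would be empty, but [la] sums to n > 0. *)
have AO_P la a : a \in AO la -> P a.
  rewrite inE /P => /and3P [-> _ gE] /=; apply/existsP.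
  case E : (enum (sink a)) => [|v s]; last first.
    by exists v; rewrite -[sink a v]/(v \in sink a) -mem_enum E mem_head.
  have := perm_size gE; rewrite /sink_gaps E !size_map => /esym /size0nil la0.
  by have /and3P [_ _] := partsP la; rewrite la0.
transitivity (\sum_(a | P a) G a).
  under eq_bigr => la _ do rewrite mulr_suml.
  rewrite (exchange_big_dep P) /= => [|la a _]; last exact: AO_P.
  apply: eq_bigr => a /andP [oa /existsP [v av]].
  have [gE g1 gn] := gapsP av.
  have part_g : is_intpart n (sort geq (gaps a)).
    rewrite /is_intpart sort_sorted /=; last by move=> x y; apply: leq_total.
    rewrite mem_sort (perm_sumn (permEl (perm_sort _ _))) gn eqxx andbT.
    by apply/negP => /(allP g1).
  rewrite (big_pred1 (IntPart part_g)) /G /=.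
    by congr (_ * _); apply: perm_big; rewrite perm_sort.
  move=> la; rewrite inE oa (acyclic_sink oa av) gE /= -val_eqE /=.
  have /and3P [la_sorted la0 _] := partsP la.
  apply/idP/eqP => [p_la|->].
    apply: (@sorted_eq _ geq) => //.
    - by move=> x y z /= yx zx; apply: leq_trans zx yx.
    - by move=> x y; rewrite -eqn_leq => /eqP.
    - by apply: sort_sorted => x y; apply: leq_total.
    rewrite perm_sym perm_sort.
    (* Gaps and parts are positive, so comparing predecessors loses nothing. *)
    have predK s : all (leq 1) s -> [seq k.+1 | k <- [seq k.-1 | k <- s]] = s.
      by elim: s => //= k s IH /andP [k0 /IH ->]; rewrite prednK.
    have la1 : all (leq 1) la by apply/allP => -[|k] // k0; case/negP: la0.
    by rewrite -(predK _ g1) -(predK _ la1); apply: perm_map.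
  by apply: perm_map; rewrite perm_sym perm_sort.
rewrite -(big_ffun_tuple _ (word_weight t e)).
rewrite (reindex_onto word_orientation orientation_word) => [|a /andP [oa _]]; last first.
  exact: orientation_wordK.
rewrite big_mkcond; apply: eq_bigr => f _; case: ifP => [/andP [/andP [oa ex_sink] /eqP fK]|].
  have bE := falls_sinks oa; rewrite /word_weight -[f in RHS]fK bE.
  rewrite /G /gaps -asc_orientation_word // size_map size_enum_ord.
  have [v av] := existsP ex_sink.
  case E : (enum (sink (word_orientation f))) => //=.
  by move: av; rewrite -[sink _ v]/(v \in sink (word_orientation f)) -mem_enum E.
move=> /negbT H; rewrite /word_weight.
case E : (falls _ _ _) => [|p s]; first by rewrite mulr0.
case/negP: H.
suff [u fu fSu] : exists2 u, f u & ~~ f (ordS u).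
  rewrite /P (word_orientationK fu fSu) eqxx andbT (word_orientationP fu fSu).
  apply/existsP; exists (ordS u); rewrite sink_word ?(word_orientationP fu fSu) //.
  by rewrite (word_orientationK fu fSu) fu.
have : p \in falls (last false [seq f i | i <- enum 'I_n]) 0 [seq f i | i <- enum 'I_n].
  by rewrite E mem_head.
rewrite falls_word => /mapP [v]; rewrite mem_filter => /andP [/andP [fv fSv] _] _.
by exists (ord_pred v); rewrite ?ord_predK.
Qed.

End Orientations.

(** * Linear independence of the elementary symmetric functions *)

(** The coefficient of m in e_la as a natural number: it counts the 0-1 matrices with row sums [la]
    and column sums the exponents of m. *)
Fixpoint esym_count (la : seq nat) (m : monomial) : nat :=
  if la is k :: la' then
    \sum_(d <- mdivisors m | (size d == k) && uniq d) esym_count la' (m `\` d)%mset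
  else (m == mset0).

Lemma elem_sym_part_cons k la m : elem_sym_part (k :: la) m =
  \sum_(d <- mdivisors m) elem_sym k d * elem_sym_part la (m `\` d)%mset.
Proof. by rewrite /elem_sym_part big_cons. Qed.

Lemma elem_sym_partE la m : elem_sym_part la m = (esym_count la m)%:R.
Proof.
elim: la m => [|k la IH] m; first by rewrite /elem_sym_part big_nil.
rewrite elem_sym_part_cons /= natr_sum [RHS]big_mkcond; apply: eq_bigr => d _.
by rewrite IH /elem_sym; case: ifP => _; rewrite ?mul1r ?mul0r.
Qed.

(** The sum of the first k parts of the conjugate partition; comparing these for all k is the
    dominance order on conjugates. *)
Definition truncated_size (la : seq nat) k := (\sum_(j <- la) minn j k)%N.

Definition staircase (la : seq nat) : seq nat := flatten [seq iota 0 j | j <- la].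

Lemma count_iota_lt k j : count (gtn k) (iota 0 j) = minn j k.
Proof.
elim: j => [|j IH]; first by rewrite min0n.
by rewrite -addn1 iotaD count_cat IH /= add0n; lia.
Qed.

Lemma count_staircase la k : count (gtn k) (staircase la) = truncated_size la k.
Proof.
rewrite /truncated_size /staircase; elim: la => [|j la IH]; rewrite ?big_nil //.
by rewrite big_cons /= count_cat IH count_iota_lt.
Qed.

(** A squarefree factor of degree j contains at most min(j, k) of the variables x_0, ...,
    x_(k-1). *)
Lemma esym_count_le la m k : (0 < esym_count la m)%N ->
  (count (gtn k) m <= truncated_size la k)%N.
Proof.
elim: la m => [|j la IH] m /=.
  by case: eqP => // -> _; rewrite enum_mset0.
rewrite /truncated_size big_cons lt0n => /eqP H.
have [/hasP [d d_m /andP [/andP [/eqP szd ud] pos]]|/hasPn none] := boolP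
  (has (fun d : monomial => [&& (size d == j) && uniq d & (0 < esym_count la (m `\` d)%mset)%N])
     (mdivisors m)); last first.
  case: H; rewrite big_seq_cond big1 // => d /andP [/none].
  by rewrite negb_and => /orP [/negPf ->//|]; rewrite -eqn0Ngt => /eqP.
rewrite mem_mdivisors in d_m.
have -> : count (gtn k) m = (count (gtn k) (d : monomial) + count (gtn k) (m `\` d)%mset)%N.
  rewrite -count_cat; apply/permP/allP => i _ /=.
  by rewrite count_cat !count_mem_mset -{1}(msetBDKC d_m) msetE2 addnC.
rewrite leq_add ?IH // leq_min -{1}szd count_size -size_filter /=.
rewrite -[X in (_ <= X)%N](size_iota 0 k); apply: uniq_leq_size.
  exact: filter_uniq.
by move=> i; rewrite mem_filter mem_iota => /andP [].
Qed.

Lemma esym_count_staircase la : (0 < esym_count la (seq_mset (staircase la)))%N.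
Proof.
elim: la => [|k la IH] /=; first by rewrite lt0b; apply/eqP/msetP => i; rewrite mset_seqE mset0E.
set d := seq_mset (iota 0 k); set r := seq_mset (staircase la).
have -> : seq_mset (staircase (k :: la)) = (d `+` r)%mset.
  by apply/msetP => i; rewrite msetE2 !mset_seqE count_cat.
have d_in : d \in mdivisors (d `+` r)%mset.
  by rewrite mem_mdivisors; apply/msubsetP => i; rewrite msetE2 leq_addr.
have d_iota : perm_eq d (iota 0 k) by apply: perm_eq_seq_mset.
rewrite big_mkcond (bigD1_seq d) ?undup_uniq //= (perm_size d_iota) size_iota eqxx.
by rewrite (perm_uniq d_iota) iota_uniq /= msetDKB addn_gt0 IH.
Qed.

(** First differences in k count the parts larger than k, second differences give the
    multiplicities. *)
Lemma truncated_size_inj n (la mu : intpart n) :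
  truncated_size la =1 truncated_size mu -> la = mu.
Proof.
move=> eq_s; apply/val_inj.
have /and3P [la_s la0 _] := partsP la; have /and3P [mu_s mu0 _] := partsP mu.
apply: (@sorted_eq _ geq) => //.
- by move=> x y z /= yx zx; apply: leq_trans zx yx.
- by move=> x y; rewrite -eqn_leq => /eqP.
have step (s : seq nat) k : truncated_size s k.+1 = (truncated_size s k + count (ltn k) s)%N.
  rewrite /truncated_size; elim: s => [|j s IH]; rewrite ?big_nil //.
  by rewrite !big_cons IH /=; lia.
have eq_c k : count (ltn k) la = count (ltn k) mu.
  by have := step la k; rewrite !eq_s step; lia.
have cS (s : seq nat) k : count (ltn k) s = (count_mem k.+1 s + count (ltn k.+1) s)%N.
  by elim: s => //= j s ->; lia.
apply/allP => -[|k] _ /=; first by rewrite !(count_memPn _).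
by have := cS la k; rewrite !eq_c cS => /addIn ->.
Qed.

(** Triangularity: let [la] maximise [f] among partitions with nonzero coefficient. Any other one
    contributing at the staircase of [la] dominates it in all truncated sizes, so by maximality
    these agree. *)
Lemma elem_sym_part_free n (c : intpart n -> {poly rat}) :
  (forall m, \sum_(la : intpart n) c la * elem_sym_part la m = 0) -> c =1 fun=> 0.
Proof.
move=> c0 la0; apply/eqP/negPn/negP => cla0.
pose f (la : intpart n) := (\sum_(k < n) truncated_size la k)%N.
case: (@arg_maxnP _ la0 (fun la => c la != 0) f) => // la cla la_max.
have := c0 (seq_mset (staircase la)); rewrite (bigD1 la) //= big1 ?addr0 => [/eqP|mu mu_la].
  rewrite mulf_eq0 (negPf cla) elem_sym_partE /= -polyC_natr polyC_eq0 Num.Theory.pnatr_eq0.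
  by rewrite eqn0Ngt esym_count_staircase.
have [->|cmu] := eqVneq (c mu) 0; first by rewrite mul0r.
rewrite elem_sym_partE; have [->|pos] := posnP (esym_count mu (seq_mset (staircase la))); first by rewrite mulr0.
have le_s k : (truncated_size la k <= truncated_size mu k)%N.
  rewrite -count_staircase -(permP (perm_eq_seq_mset (staircase la))).
  exact: (esym_count_le _ pos).
case/negP: mu_la; apply/eqP/esym/truncated_size_inj => k.
have [kn|nk] := ltnP k n.
  have fE nu : f nu = (truncated_size nu k +
      \sum_(i < n | i != Ordinal kn) truncated_size nu i)%N.
    by rewrite /f (bigD1 (Ordinal kn)).
  have := la_max mu cmu; rewrite !fE.
  have : (\sum_(i < n | i != Ordinal kn) truncated_size la i <=
          \sum_(i < n | i != Ordinal kn) truncated_size mu i)%N by apply: leq_sum.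
  by have := le_s k; lia.
have full (nu : intpart n) : truncated_size nu k = n.
  have /and3P [_ _ /eqP {2}<-] := partsP nu; have /andP [_ /allP nu_n] := intpart_bounds nu.
  rewrite sumnE /truncated_size big_seq [RHS]big_seq; apply: eq_bigr => j /nu_n.
  by move=> jn; apply/minn_idPl/(leq_trans jn).
by rewrite !full.
Qed.

(** * Restriction to finitely many variables *)

Lemma chromatic_qsym_bounded (V : finType) (E : rel V) (v0 : V) N (m : monomial) :
  {in m, forall i, i <= N}%N ->
  chromatic_qsym E m =
  \sum_(k : {ffun V -> 'I_N.+1} | proper_coloring E (fun v => val (k v))
          && (seq_mset [seq val (k v) | v : V] == m))
     'X^(asc_coloring E (fun v => val (k v))).
Proof.
move=> mN.
have in_m (k : {ffun V -> 'I_N.+1}) v :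
    seq_mset [seq val (k v) | v : V] == m -> val (k v) \in finsupp m.
  move=> /eqP <-; rewrite multiset.msuppE (perm_mem (perm_eq_seq_mset _)).
  by apply: map_f; rewrite mem_enum.
(* If the support is empty, no colour is left for [v0] and both sums are empty; otherwise [c0] is
   the default value in [h]. *)
case: (fset_0Vmem (finsupp m)) => [m0|[c0 c0m]].
  have none j : (j \in finsupp m) = false by rewrite m0.
  rewrite [LHS]big_pred0 => [|k]; last by have := valP (k v0); rewrite none.
  rewrite big_pred0 // => k; apply/negP => /andP [_ /(@in_m k v0)].
  by rewrite none.
pose h (k : {ffun V -> 'I_N.+1}) : {ffun V -> finsupp m} :=
  [ffun v => insubd [` c0m]%fset (val (k v))].
pose h' (k : {ffun V -> finsupp m}) : {ffun V -> 'I_N.+1} := [ffun v => inord (val (k v))].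
have h'E k : (fun v => val (h' k v)) =1 (fun v => val (k v)).
  move=> v; rewrite ffunE /= inordK // ltnS mN //.
  by rewrite -multiset.msuppE; apply: valP.
have propE k k' : k =1 k' -> proper_coloring E k = proper_coloring E k'.
  by move=> kk; apply: eq_forallb => u; apply: eq_forallb => v; rewrite !kk.
have ascE k k' : k =1 k' -> asc_coloring E k = asc_coloring E k'.
  by move=> kk; apply: eq_card => u; rewrite !inE !kk.
rewrite [RHS](reindex_onto h' h) => [|k /andP [_ km]]; last first.
  by apply/ffunP => v; rewrite !ffunE insubdK ?inord_val //; apply: in_m km.
rewrite /chromatic_qsym; apply: eq_big => k.
  have -> : [seq val (h' k v) | v : V] = [seq val (k v) | v : V] by apply: eq_map.
  rewrite (propE _ _ (h'E k)) -[LHS]andbT; congr (_ && _).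
  apply/esym/eqP/ffunP => v; rewrite ffunE.
  by rewrite (h'E k v) valKd.
by rewrite (ascE _ _ (h'E k)).
Qed.

Section Representation.

Variable N : nat.

Definition mnm_of (m : monomial) : 'X_{1..N.+1} := [multinom m (val i) | i < N.+1].

Definition bounded (m : monomial) := forall i, (N < i)%N -> m i = 0%N.

Lemma mnm_ofE m i : mnm_of m i = m (val i).
Proof. by rewrite mnmE. Qed.

Lemma mnm_of_inj d d' : bounded d -> bounded d' -> mnm_of d = mnm_of d' -> d = d'.
Proof.
move=> bd bd' dd'; apply/msetP => i; have [iN|Ni] := leqP i N; last by rewrite bd ?bd'.
by have := mnm_ofE d (Ordinal (iN : i < N.+1)%N); rewrite dd' mnm_ofE.
Qed.

Lemma bounded_le m d : bounded m -> (d `<=` m)%mset -> bounded d.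
Proof. by move=> bm /msubsetP dm i /bm mi; have := dm i; rewrite mi leqn0 => /eqP. Qed.

Lemma mnm_of_onto (k : 'X_{1..N.+1}) : exists2 d, mnm_of d = k & bounded d.
Proof.
pose s := flatten [seq nseq (k i) (val i) | i <- enum 'I_N.+1].
have sE j : count_mem j s = (\sum_(i < N.+1 | val i == j) k i)%N.
  rewrite /s count_flatten -map_comp sumnE big_map big_enum [RHS]big_mkcond /=.
  apply: eq_bigr => i _; rewrite count_nseq /=.
  by case: eqP => _; rewrite ?mul1n.
exists (seq_mset s) => [|i Ni].
  by apply/mnmP => i; rewrite mnm_ofE mset_seqE sE (big_pred1 i).
rewrite mset_seqE sE big_pred0 // => j; apply/eqP => ij.
by have := ltn_ord j; rewrite -[nat_of_ord j]/(val j) ij; lia.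
Qed.

(** For bounded m, [mnm_of] maps the divisors of m bijectively onto the exponent vectors below
    [mnm_of m]. *)
Lemma mcoeffM_mnm_of (R : nzRingType) (p q : {mpoly R[N.+1]}) m : bounded m ->
  (p * q)@_(mnm_of m) =
  \sum_(d <- mdivisors m) p@_(mnm_of d) * q@_(mnm_of (m `\` d)%mset).
Proof.
move=> bm; rewrite (mcoeff_poly_mul_lin p q (ltnSn _)).
have subE d : (d `<=` m)%mset -> mnm_of (m `\` d)%mset = (mnm_of m - mnm_of d)%MM.
  by move=> dm; apply/mnmP => i; rewrite mnmBE !mnm_ofE msetE2.
rewrite big_seq [RHS](eq_bigr (fun d => p@_(mnm_of d) * q@_(mnm_of m - mnm_of d))) => [|d]; last first.
  by rewrite mem_mdivisors => /subE ->.
rewrite -big_seq; pose F k := p@_k * q@_(mnm_of m - k).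
pose T := 'X_{1..N.+1 < (mdeg (mnm_of m)).+1}.
pose bs := [seq b : T <- index_enum T | (bmnm b <= mnm_of m)%MM].
transitivity (\sum_(k <- [seq bmnm b | b <- bs]) F k).
  by rewrite big_map big_filter.
transitivity (\sum_(k <- [seq mnm_of d | d <- mdivisors m]) F k); last by rewrite big_map.
apply: perm_big; apply: uniq_perm.
- by rewrite map_inj_uniq ?filter_uniq ?index_enum_uniq //; apply: val_inj.
- rewrite map_inj_in_uniq ?undup_uniq // => d d'; rewrite !mem_mdivisors => dm d'm.
  by apply: mnm_of_inj; apply: bounded_le bm _.
move=> k; apply/mapP/mapP => [[b]|[d]].
  rewrite mem_filter => /andP [bm' _] ->.
  have [d dE bd] := mnm_of_onto b; exists d => //; rewrite mem_mdivisors.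
  apply/msubsetP => i; have [iN|Ni] := leqP i N; last by rewrite bd.
  have /mnm_lepP/(_ (Ordinal (iN : i < N.+1)%N)) := bm'.
  by rewrite -dE !mnm_ofE.
rewrite mem_mdivisors => dm ->.
have dmM : (mnm_of d <= mnm_of m)%MM.
  by apply/mnm_lepP => i; rewrite !mnm_ofE; apply: (msubsetP dm).
have lt : (mdeg (mnm_of d) < (mdeg (mnm_of m)).+1)%N.
  by rewrite ltnS -(submK dmM) mdegD leq_addl.
by exists (BMultinom lt) => //; rewrite mem_filter dmM mem_index_enum.
Qed.

Lemma elem_sym_mcoeff k (d : monomial) : bounded d ->
  elem_sym k d = (mesym N.+1 {poly rat} k)@_(mnm_of d).
Proof.
move=> bd; rewrite mcoeff_mesym /elem_sym /mechar; congr ((nat_of_bool _)%:R).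
have -> : uniq d = [forall i, (mnm_of d i <= 1)%N].
  apply/idP/forallP => [ud i|H].
    by rewrite mnm_ofE -count_mem_mset count_uniq_mem ?leq_b1.
  apply/count_mem_uniq => i; rewrite count_mem_mset.
  have [iN|Ni] := leqP i N; last by rewrite bd // -[RHS]/(nat_of_bool _) -mset_neq0 bd.
  have := H (Ordinal (iN : i < N.+1)%N); rewrite mnm_ofE /= -mset_neq0.
  by case: (d i) => [|[]].
congr ((_ == _) && _).
rewrite size_mset mdegE.
have -> : (\sum_(i < N.+1) mnm_of d i = \sum_(0 <= i < N.+1) d i)%N.
  by rewrite big_mkord; apply: eq_bigr => i _; rewrite mnm_ofE.
rewrite [RHS](bigID (fun i => i \in finsupp d)) /= [X in (_ + X)%N]big1 ?addn0; last first.
  by move=> i; rewrite multiset.msuppE => /mset_eq0P.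
rewrite -[RHS]big_filter; apply: perm_big; apply: uniq_perm; rewrite ?fset_uniq ?filter_uniq ?iota_uniq //.
move=> i; rewrite mem_filter mem_index_iota /= andb_idr // => id.
by rewrite ltnNge; apply/negP => /bd /mset_eq0P; rewrite -multiset.msuppE id.
Qed.

Lemma elem_sym_part_mcoeff la m : bounded m ->
  elem_sym_part la m = (\prod_(k <- la) mesym N.+1 {poly rat} k)@_(mnm_of m).
Proof.
have b0 : bounded mset0 by move=> i _; rewrite mset0E.
elim: la m => [|k la IH] m bm.
  rewrite /elem_sym_part !big_nil mcoeff1 /series_one; congr ((nat_of_bool _)%:R).
  apply/eqP/eqP => [->|m0]; first by apply/mnmP => i; rewrite mnm_ofE mnm0E mset0E.
  by apply: mnm_of_inj => //; rewrite m0; apply/mnmP => i; rewrite mnm_ofE mnm0E mset0E.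
rewrite elem_sym_part_cons big_cons mcoeffM_mnm_of // big_seq [RHS]big_seq.
apply: eq_bigr => d; rewrite mem_mdivisors => dm.
have bd := bounded_le bm dm.
rewrite IH; last by apply: bounded_le bm _; apply: msubsetDl.
by congr (_ * _); apply: elem_sym_mcoeff.
Qed.

End Representation.

(** Colourings of the cycle are closed walks on the colours: the zero diagonal kills the improper
    ones, and each ascent along an arc contributes t. *)
Lemma chromatic_qsym_mcoeff N m (mon : monomial) : bounded N mon ->
  chromatic_qsym (@dcycle m.+2) mon =
  (\tr (cycle_mx (fun i : 'I_N.+1 => 'X_i) ('X%:MP : {mpoly {poly rat}[N.+1]})
          ^+ m.+2))@_(mnm_of N mon).
Proof.
move=> bm; rewrite (@chromatic_qsym_bounded _ _ ord0 N); last first.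
  by move=> i; rewrite -multiset.mset_gt0 => mi; rewrite leqNgt; apply/negP => /bm mi0;
     rewrite mi0 in mi.
rewrite tr_expmx raddf_sum /= big_mkcond; apply: eq_bigr => k _.
have properE : proper_coloring (@dcycle m.+2) (fun v => val (k v)) =
    [forall i, k i != k (ordS i)].
  apply/forallP/forallP => [H i|H u].
    by have /forallP/(_ (ordS i)) := H i; rewrite /adjacent /dcycle /= eqxx.
  apply/forallP => v; rewrite /adjacent /dcycle /=; apply/implyP => /orP [] /eqP ->.
    exact: H.
  by rewrite eq_sym; apply: H.
have ascE : asc_coloring (@dcycle m.+2) (fun v => val (k v)) =
    (\sum_(i < m.+2) (k i < k (ordS i)))%N.
  rewrite /asc_coloring -sum1_card big_mkcond /=.
  pose G (i j : 'I_m.+2) : nat := (j == ordS i) && (k i < k j)%N.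
  transitivity (\sum_p G p.1 p.2)%N.
    by apply: eq_bigr => p _; rewrite inE /G /dcycle /=; case: (_ && _).
  rewrite -(pair_bigA _ G); apply: eq_bigr => i _.
  rewrite (bigD1 (ordS i)) //= /G eqxx big1 ?addn0 // => j /negPf ij.
  by rewrite ij.
under eq_bigr => i _ do rewrite mxE.
rewrite big_split /=.
have -> : \prod_(i < m.+2) 'X_(k (ordS i)) = 'X_[\sum_(i < m.+2) U_(k i)] :> {mpoly {poly rat}[N.+1]}.
  by rewrite -mprodXE [RHS](reindex_inj (@ordS_inj m.+2)).
have kE : mnm_of N (seq_mset [seq val (k v) | v : 'I_m.+2]) = (\sum_(i < m.+2) U_(k i))%MM.
  apply/mnmP => j; rewrite mnm_ofE mset_seqE mnm_sumE count_map -sum1_count.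
  rewrite big_enum_cond big_mkcond; apply: eq_bigr => i _ /=.
  by rewrite mnm1E val_eqE; case: eqP.
have mnmE : ((\sum_(i < m.+2) U_(k i))%MM == mnm_of N mon) =
    (seq_mset [seq val (k v) | v : 'I_m.+2] == mon).
  rewrite -kE; apply/eqP/eqP => [|-> //]; apply: mnm_of_inj => // i Ni.
  rewrite mset_seqE; apply/count_memPn/negP => /mapP [v _ iv].
  by have := ltn_ord (k v); rewrite ltnS leqNgt -[nat_of_ord _]/(val (k v)) -iv Ni.
rewrite properE; case: forallP => [kP|kP] /=.
  rewrite (eq_bigr (fun i => 'X%:MP ^+ (k i < k (ordS i))%N)) => [|i _]; last first.
    by have := kP i; rewrite -val_eqE /=; case: ltngtP.
  rewrite prodrXr -ascE -rmorphXn /= mulrC mcoeffCM mcoeffX mnmE.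
  by case: ifP => _; rewrite ?mulr1 ?mulr0.
have [i /negPn /eqP ki] : exists i, ~~ (k i != k (ordS i)).
  by apply/existsP; rewrite -negb_forall; apply/negP => /forallP.
by rewrite [X in _ * X](bigD1 i) //= -ki ltnn mul0r mulr0 mcoeff0.
Qed.

(** * Comparison of the two recursions and uniqueness of the expansion *)

Lemma chromatic_qsym_cycle m :
  e_expansion (chromatic_qsym (@dcycle m.+2))
    (fun la => \sum_(a in AO la) 'X^(asc_orientation (@dcycle m.+2) a)).
Proof.
move=> mon; pose N := (\max_(i <- mon) i)%N.
have bm : bounded N mon.
  move=> i Ni; apply/multiset.mset_eq0P; apply: contraTN Ni => i_mon.
  by rewrite -leqNgt /N (@leq_bigmax_seq _ _ xpredT id).
pose t : {mpoly {poly rat}[N.+1]} := 'X%:MP; pose e := mesym N.+1 {poly rat}.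
have t1 : t != 1.
  apply/eqP => /(congr1 (mcoeff 0%MM)); rewrite mcoeff1 mcoeffC eqxx mulr1.
  by move=> /(congr1 (size \o polyseq)) /=; rewrite size_polyX size_poly1.
rewrite (chromatic_qsym_mcoeff _ bm).
(* Both sequences satisfy [newton] with coefficients (t + ... + t^m) e_(m+1); index m + 1 stands for
   the power m + 2. *)
rewrite (newton_unique (newton_cycle_mx _ t1) (newton_words t e) m.+1).
rewrite -sum_AO_words raddf_sum /=; apply: eq_bigr => la _.
rewrite (elem_sym_part_mcoeff _ bm) -mcoeffCM; congr (_@_ _); congr (_ * _).
by rewrite rmorph_sum; apply: eq_bigr => a _; rewrite rmorphXn.
Qed.

Theorem proposition13 (n : nat) (hn : (2 <= n)%N) :
  (exists c : intpart n -> {poly rat},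
     e_expansion (chromatic_qsym (@dcycle n)) c)
  /\ (forall c : intpart n -> {poly rat},
        e_expansion (chromatic_qsym (@dcycle n)) c ->
        forall la : intpart n,
          c la = \sum_(a in AO la) 'X^(asc_orientation (@dcycle n) a)).
Proof.
case: n hn => [|[|m]] // _; split; first by eexists; apply: chromatic_qsym_cycle.
(* The difference of two expansions is a vanishing combination of the e_la. *)
move=> c cE la; apply/eqP; rewrite -subr_eq0; apply/eqP; move: la.
apply: elem_sym_part_free => mon.
under eq_bigr => la _ do rewrite mulrBl.
by rewrite sumrB -cE -chromatic_qsym_cycle subrr.
Qed.
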